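(* For $k\ge 1$ let $u_k$ be the coefficient of $x^{k-1}$ in the power series expansion of $$\frac{1+502x+x^2}{(1-x)(1-398x+x^2)}=1+901x+359101x^2+142921801x^3+\cdots.$$ Then, for all integers $k\ge 1$, $$u_k=\frac{1}{44}\Bigl(5\bigl(10-3\sqrt{11}\bigr)^{2k-1}+5\bigl(10+3\sqrt{11}\bigr)^{2k-1}-56\Bigr)$$ and $$u_{k+1}=252+199u_k+30\sqrt{(3+2u_k)(23+22u_k)}.$$
   Context: The square root of a nonnegative real number denotes its nonnegative square root. *)

(* Defs.v *)
From Stdlib Require Import Reals.
From Coquelicot Require Import Coquelicot.
Open Scope R_scope.

(* [a n] is the coefficient of x^n in the power series expansion of [f] at 0. *)
Definition is_power_series_expansion (f : R -> R) (a : nat -> R) : Prop :=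
  locally 0 (fun x => is_pseries a x (f x)).

Definition gen_fun (x : R) : R :=
  (1 + 502 * x + x ^ 2) / ((1 - x) * (1 - 398 * x + x ^ 2)).

(* Main.v *)
Require Import Defs.
From Stdlib Require Import Reals.
From Coquelicot Require Import Coquelicot.
From Stdlib Require Import Lra Lia ssreflect.
Open Scope R_scope.

(** Partial fractions: the roots of [1 - 398 x + x^2] are the inverses of
    [(10 + 3 sqrt 11)^2 = 199 + 60 sqrt 11] and of its conjugate, so the
    coefficients are combinations of three geometric sequences.  With
    [p = (10 + 3 sqrt 11)^(2k-1)] and [q = (10 - 3 sqrt 11)^(2k-1)] one has
    [p q = 1] and [p >= q], hence [(3 + 2 u_k) (23 + 22 u_k)] is the square of
    [5 sqrt 11 (p - q) / 22], which makes the recurrence linear in [p] and [q]. *)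

(** Outside the disk of convergence the terms do not tend to 0, as those of a convergent series
    must. *)
Lemma ex_pseries_le_CV_radius (a : nat -> R) (x : R) :
  ex_pseries a x -> Rbar_le (Rabs x) (CV_radius a).
Proof.
  intros [l Hl].
  apply Rbar_not_lt_le; intros Hlt.
  apply (CV_disk_outside a x Hlt).
  apply ex_series_lim_0; exists l.
  apply is_pseries_R; exact Hl.
Qed.

(** The series converges at the nonzero point [d / 2] of the neighbourhood. *)
Lemma power_series_expansion_CV_radius (f : R -> R) (a : nat -> R) :
  is_power_series_expansion f a -> Rbar_lt 0 (CV_radius a).
Proof.
  intros [d Hd].
  assert (Hd0 := cond_pos d).
  apply Rbar_lt_le_trans with (Rabs (d / 2)).
  - simpl; rewrite Rabs_pos_eq; lra.
  - apply ex_pseries_le_CV_radius; exists (f (d / 2)); apply Hd.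
    rewrite /ball /= /AbsRing_ball /abs /minus /plus /opp /=.
    rewrite Rabs_pos_eq; lra.
Qed.

Lemma power_series_expansion_unique (f : R -> R) (a b : nat -> R) :
  is_power_series_expansion f a -> is_power_series_expansion f b ->
  forall n : nat, a n = b n.
Proof.
  intros Ha Hb n.
  apply PSeries_ext_recip.
  - exact (power_series_expansion_CV_radius f a Ha).
  - exact (power_series_expansion_CV_radius f b Hb).
  - apply: filter_imp (filter_and _ _ Ha Hb); intros x [Hax Hbx].
    rewrite (is_pseries_unique _ _ _ Hax) (is_pseries_unique _ _ _ Hbx).
    reflexivity.
Qed.

Lemma is_pseries_geom (c r x : R) :
  Rabs (r * x) < 1 -> is_pseries (fun n => c * r ^ n) x (c * / (1 - r * x)).
Proof.
  intros H.
  apply is_pseries_R.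
  apply is_series_ext with (fun n => scal c ((r * x) ^ n)).
  - intros n; rewrite Rpow_mult_distr /scal /= /mult /=; ring.
  - apply: (is_series_scal (V := R_NormedModule) c); exact (is_series_geom _ H).
Qed.

Lemma sqrt11_sqr : sqrt 11 * sqrt 11 = 11.
Proof. apply sqrt_sqrt; lra. Qed.

Lemma sqrt11_bounds : 3 < sqrt 11 < 10 / 3.
Proof.
  assert (H := sqrt11_sqr); assert (H0 := sqrt_pos 11); split; nra.
Qed.

(** The constant term is written with [1 ^ n] so that [is_pseries_geom] applies to all three
    summands. *)
Lemma gen_fun_expansion :
  is_power_series_expansion gen_fun
    (fun n => 5 * (10 - 3 * sqrt 11) / 44 * ((10 - 3 * sqrt 11) ^ 2) ^ n
              + (5 * (10 + 3 * sqrt 11) / 44 * ((10 + 3 * sqrt 11) ^ 2) ^ n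
                 + - (56 / 44) * 1 ^ n)).
Proof.
  (* Since [sqrt 11 < 10 / 3], the largest ratio [199 + 60 * sqrt 11] is below 400, so all three
     geometric series converge for [|x| < 1 / 400]. *)
  assert (He : 0 < / 400) by lra.
  exists (mkposreal _ He); intros x Hx.
  rewrite /ball /= /AbsRing_ball /abs /minus /plus /opp /= in Hx.
  apply Rabs_def2 in Hx; destruct Hx as [Hx1 Hx2].
  assert (Hs := sqrt11_sqr).
  destruct sqrt11_bounds as [Hl Hu].
  set (s := sqrt 11) in *.
  assert (Ha : (10 + 3 * s) ^ 2 = 199 + 60 * s) by (ring [Hs]).
  assert (Hb : (10 - 3 * s) ^ 2 = 199 - 60 * s) by (ring [Hs]).
  rewrite Ha Hb.
  assert (A1 : -1 < (199 + 60 * s) * x < 1) by (split; nra).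
  assert (B1 : -1 < (199 - 60 * s) * x < 1) by (split; nra).
  replace (gen_fun x) with
    (5 * (10 - 3 * s) / 44 * / (1 - (199 - 60 * s) * x)
     + (5 * (10 + 3 * s) / 44 * / (1 - (199 + 60 * s) * x)
        + - (56 / 44) * / (1 - 1 * x))).
  - apply (is_pseries_plus (V := R_NormedModule)); [|apply (is_pseries_plus (V := R_NormedModule))];
      apply is_pseries_geom, Rabs_def1; lra.
  - unfold gen_fun.
    (* The conjugate ratios have sum 398 and product [199 ^ 2 - 3600 * 11 = 1]. *)
    replace (1 - 398 * x + x ^ 2)
      with ((1 - (199 - 60 * s) * x) * (1 - (199 + 60 * s) * x))
      by (ring [Hs]).
    field_simplify_eq; [ring [Hs] | repeat split; lra].
Qed.

Lemma coefficient_closed_form (u : nat -> R) (k : nat) :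
  is_power_series_expansion gen_fun (fun n : nat => u (n + 1)%nat) ->
  (1 <= k)%nat ->
  u k = 1 / 44 * (5 * (10 - 3 * sqrt 11) ^ (2 * k - 1)
                  + 5 * (10 + 3 * sqrt 11) ^ (2 * k - 1) - 56).
Proof.
  intros hu Hk.
  assert (H := power_series_expansion_unique _ _ _ hu gen_fun_expansion (k - 1)).
  cbv beta in H.
  replace (k - 1 + 1)%nat with k in H by lia.
  rewrite H pow1.
  (* The odd factor is the one carried by the coefficient of the geometric sequence. *)
  replace (2 * k - 1)%nat with (S (2 * (k - 1))) by lia.
  rewrite -!(tech_pow_Rmult _ (2 * (k - 1))) !pow_mult; field.
Qed.

Theorem proposition6 (u : nat -> R)
  (hu : is_power_series_expansion gen_fun (fun n : nat => u (n + 1)%nat)) :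
  (u 1%nat = 1 /\ u 2%nat = 901 /\ u 3%nat = 359101 /\ u 4%nat = 142921801) /\
  forall k : nat, (1 <= k)%nat ->
    u k = 1 / 44 * (5 * (10 - 3 * sqrt 11) ^ (2 * k - 1)
                    + 5 * (10 + 3 * sqrt 11) ^ (2 * k - 1) - 56) /\
    u (k + 1)%nat = 252 + 199 * u k
                    + 30 * sqrt ((3 + 2 * u k) * (23 + 22 * u k)).
Proof.
  assert (Hs := sqrt11_sqr).
  split.
  - repeat split; rewrite coefficient_closed_form; try lia; try exact hu;
      simpl; field_simplify_eq; ring [Hs].
  - intros k Hk; split; [exact (coefficient_closed_form u k hu Hk)|].
    rewrite (coefficient_closed_form u (k + 1) hu); [|lia].
    rewrite (coefficient_closed_form u k hu Hk).
    replace (2 * (k + 1) - 1)%nat with (2 + (2 * k - 1))%nat by lia.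
    rewrite !pow_add.
    destruct sqrt11_bounds as [Hl Hu].
    set (s := sqrt 11) in *.
    set (m := (2 * k - 1)%nat).
    assert (Hpq : (10 - 3 * s) ^ m * (10 + 3 * s) ^ m = 1).
    { rewrite -Rpow_mult_distr.
      replace ((10 - 3 * s) * (10 + 3 * s)) with 1 by (ring [Hs]).
      apply pow1. }
    (* Monotonicity of powers requires [10 - 3 * s >= 0], which is the bound [s < 10 / 3]. *)
    assert (Hle : (10 - 3 * s) ^ m <= (10 + 3 * s) ^ m)
      by (apply pow_incr; lra).
    set (q := (10 - 3 * s) ^ m) in *.
    set (p := (10 + 3 * s) ^ m) in *.
    (* The factors are [5 * (p + q + 2) / 22] and [5 * (p + q - 2) / 2]; since [p * q = 1],
       [(p + q) ^ 2 - 4 = (p - q) ^ 2]. *)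
    replace ((3 + 2 * _) * _) with (Rsqr (5 * s * (p - q) / 22)).
    + rewrite sqrt_Rsqr; [field_simplify_eq; ring [Hs]|].
      assert (0 <= s * (p - q)) by (apply Rmult_le_pos; lra).
      lra.
    + unfold Rsqr; field_simplify_eq; ring [Hs Hpq].
Qed.
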